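(* Let $\alpha\in(0,1/3)$ be given and let $v_\nu$, $\nu\in(0,1)$, be the solutions to the forced Navier--Stokes equations constructed by Bru\`e, Colombo, Crippa, De Lellis and Sorella (recalled in the context), satisfying $$\sup_{\nu\in(0,1)}\Big(\|v_\nu\|_{L^3(0,1;C^\alpha)}+\|v_\nu\|_{L^\infty(0,1;L^\infty)}\Big)<\infty .$$ Then the third order absolute structure function exponents $$\zeta_3:=\liminf_{\ell_I\to0}\inf_{\nu\in(0,1)}\inf_{\ell\in[\ell_D,\ell_I]}\frac{\log\big(\int_0^1S_3^\nu(r,\ell)\,\mathrm dr\big)}{\log\ell},\qquad \bar\zeta_3:=\limsup_{\ell_I\to0}\liminf_{\nu\to0}\sup_{\ell\in[\ell_D,\ell_I]}\frac{\log\big(\int_0^1S_3^\nu(r,\ell)\,\mathrm dr\big)}{\log\ell},$$ where $\ell_D=\ell_D(\nu)$ is the dissipation scale described in the context, satisfy $$3\alpha\le\zeta_3\le\bar\zeta_3\le1 .$$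
   Context: $\mathbb T^3$ is the three-dimensional flat torus; functions on it are identified with periodic functions on $\mathbb R^3$; $\langle\cdot,\cdot\rangle$ is the $L^2(\mathbb T^3)$ inner product and $\langle u,w\rangle(t)=\langle u(t),w(t)\rangle$; $L^2,H^s,C^\alpha$ denote spaces over $\mathbb T^3$; $T_hv(t,x)=v(t,x+h)$ and $\delta_hv=T_hv-v$ for $h\in\mathbb R^3$. Forced Navier--Stokes equations on $[0,1]\times\mathbb T^3$: $\partial_t v_\nu+v_\nu\cdot\nabla v_\nu+\nabla p_\nu=\nu\Delta v_\nu+f_\nu$, $\operatorname{div}v_\nu=0$, $v_\nu(0)=v_{in}$. Leray--Hopf solution: given a divergence-free $v_{in}\in L^2$ and $f_\nu\in L^1(0,1;L^2)$, it is a divergence-free vector field $v_\nu\in L^\infty(0,1;L^2)\cap L^2(0,1;H^1)\cap C_w([0,1];L^2)$ with $v_\nu(0)=v_{in}$ satisfying the equations in the weak sense (for every $t\in[0,1]$, integrated over $[0,t]$ and tested against every $\psi\in C^\infty(\mathbb T^3)$), and for all $t\in(0,1]$ the energy inequality $$\|v_\nu(t)\|_{L^2}^2+2\nu\int_0^t\|\nabla v_\nu\|_{L^2}^2\mathrm ds\le\|v_{in}\|_{L^2}^2+2\int_0^t\langle f_\nu,v_\nu\rangle\mathrm ds .$$ The solutions of Bru\`e, Colombo, Crippa, De Lellis and Sorella (Theorem A of their 2022 work): for any $\alpha<1/3$ they construct $\sigma>0$, a divergence-free initial datum $v_{in}\in C^\infty(\mathbb T^3;\mathbb R^3)$ with $\int_{\mathbb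 T^3}v_{in}=0$ and a family of forces $\{f_\nu\}_{\nu\in[0,1]}\subset C^\infty([0,1]\times\mathbb T^3;\mathbb R^3)$ such that for each $\nu\in(0,1)$ there is a unique Leray--Hopf solution $v_\nu$ with $v_\nu(0)=v_{in}$, satisfying $\sup_{\nu\in(0,1)}(\|v_\nu\|_{L^3(0,1;C^\alpha)}+\|v_\nu\|_{L^\infty(0,1;L^\infty)})<\infty$ and the anomalous dissipation $\limsup_{\nu\to0}\nu\int_0^1\int_{\mathbb T^3}|\nabla v_\nu|^2\mathrm dx\,\mathrm dt>\frac14$. In particular the energy inequality holds with equality. Furthermore $f_\nu\to f_0$ in $L^{1+\sigma}(0,1;C^\sigma(\mathbb T^3))$ and $v_\nu\to v_0$ in $L^2(0,1;L^2)$ as $\nu\to0$, and $(v_0,f_0)$ satisfies the equations with $\nu=0$. Third order absolute structure function: for $\ell>0$, $t\in[0,1]$, $$S_3^\nu(t,\ell)=\frac1{4\pi}\int_{\mathbb S^2}\int_{\mathbb T^3}|\delta_{\ell\hat n}v_\nu(t,x)|^3\,\mathrm dx\,\mathrm dS(\hat n).$$ Dissipation scale $\ell_D$: these solutions satisfy, for some $\sigma>0$, $a\in(0,1)$, $q\in[1,2]$, the bound $\sup_{\nu\in(0,1)}(\|v_\nu\|_{L^\infty(0,1;L^2)}+\|v_\nu\|_{L^q(0,1;H^a)}+\|f_\nu\|_{L^{1+\sigma}(0,1;L^2)})<\infty$. Under this bound there exists $\ell_D=\nu^K$ with some $0<K<\frac1{2-aq}$ such that $$\lim_{\ell_I\to0}\limsup_{\nu\to0}\sup_{\ell\in[\ell_D,\ell_I]}\left|\int_0^1\frac{S_0^\nu(r,\ell)}{\ell}\,\mathrm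 dr+\frac43\varepsilon_\nu^\ell\right|=0,$$ where $S_0^\nu(t,\ell)=\frac1{4\pi}\int_{\mathbb S^2}\int_{\mathbb T^3}|\delta_{\ell\hat n}v_\nu|^2\,\delta_{\ell\hat n}v_\nu\cdot\hat n\,\mathrm dx\,\mathrm dS(\hat n)$ and $\varepsilon_\nu^\ell=\frac12\|v_\nu(0)\|_{L^2}^2-\frac{3}{8\pi\ell^3}\int_0^\ell\tau^2\int_{\mathbb S^2}\langle v_\nu,T_{\tau\hat n}v_\nu\rangle(1)\,\mathrm dS(\hat n)\,\mathrm d\tau+\int_0^1\langle f_\nu,v_\nu\rangle\,\mathrm dr$. This $\ell_D$ is the one used in the claim. *)

(* Defs.v *)
From HB Require Import structures.
From mathcomp Require Import all_boot all_order all_algebra.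
From mathcomp Require Import all_classical all_reals all_analysis.

Set Implicit Arguments.
Unset Strict Implicit.
Unset Printing Implicit Defensive.

Import Order.TTheory GRing.Theory Num.Theory.
Import numFieldNormedType.Exports.

Local Open Scope classical_set_scope.
Local Open Scope ring_scope.

Section space.
Context {R : realType}.

Definition V3 := 'rV[R]_3.

Definition vec3 (x y z : R) : V3 := \row_(i < 3) [:: x; y; z]`_i.

(* The library's norm on 'rV[R]_3 is the sup norm, hence the Euclidean one is
   introduced here. *)
Definition dot (x y : V3) : R := \sum_(i < 3) x 0 i * y 0 i.
Definition enorm (x : V3) : R := Num.sqrt (dot x x).

Definition component (u : V3 -> V3) (i : 'I_3) : V3 -> R := fun x => u x 0 i.

Definition pderiv (i : 'I_3) (g : V3 -> R) : V3 -> R :=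
  'D_(delta_mx 0 i : V3) g.

(* C^k through iterated directional derivatives in all directions; used on
   finite-dimensional spaces only. *)
Fixpoint Ck (V : normedModType R) (k : nat) (g : V -> R) : Prop :=
  if k is k'.+1 then
    continuous g /\
    forall w : V, (forall x, derivable g x w) /\ Ck k' ('D_w g : V -> R)
  else continuous g.

Definition smooth (V : normedModType R) (g : V -> R) : Prop :=
  forall k, Ck k g.

Definition smooth_field (u : V3 -> V3) : Prop := forall i, smooth (component u i).

(* The torus is R^3/Z^3; functions on it are the Z^3-periodic functions on R^3,
   integrated over the unit cube. R^3 is 'rV[R]_3 for its linear and topological
   structure and R * R * R for its measurable structure, with pt relating the
   two. *)
Definition Z3_periodic (T : Type) (g : V3 -> T) : Prop :=
  forall (x : V3) (i : 'I_3), g (x + delta_mx 0 i) = g x.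

Definition pt (p : R * R * R) : V3 := vec3 p.1.1 p.1.2 p.2.

Definition unit_cube : set (R * R * R) :=
  (`[0, 1]%classic `*` `[0, 1]%classic) `*` `[0, 1]%classic.

Lemma measurable_unit_cube : measurable unit_cube.
Proof. by apply: measurableX => //; apply: measurableX. Qed.

Definition torus : set (measurableTypeR R * measurableTypeR R * measurableTypeR R)
    -> \bar R :=
  mrestr ((@lebesgue_measure R \x @lebesgue_measure R)%E \x
          @lebesgue_measure R)%E measurable_unit_cube.
HB.instance Definition _ := Measure.on torus.

Definition unit_time : set (measurableTypeR R) -> \bar R :=
  mrestr (@lebesgue_measure R) (measurable_itv `[(0 : R), 1]).
HB.instance Definition _ := Measure.on unit_time.

Definition torus_measurable (u : V3 -> V3) : Prop :=
  forall i, measurable_fun [set: R * R * R] (fun p => u (pt p) 0 i).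

(* [0, 1] x R^3 *)
Definition time_space : set (R * (R * R * R)) := `[0, 1]%classic `*` setT.

Definition inner (u w : V3 -> V3) : \bar R :=
  (\int[torus]_p (dot (u (pt p)) (w (pt p)))%:E)%E.

Definition L2norm (u : V3 -> V3) : \bar R :=
  ('N[torus]_(2%:E)[(fun p => (enorm (u (pt p)))%:E)])%E.

Definition Linftynorm (u : V3 -> V3) : \bar R :=
  ('N[torus]_(+oo)[(fun p => (enorm (u (pt p)))%:E)])%E.

(* The C^s norm for 0 < s < 1. It is pointwise: a field in C^s is represented by
   its continuous representative. *)
Definition Cnorm (s : R) (u : V3 -> V3) : \bar R :=
  (ereal_sup [set (enorm (u x))%:E | x in [set: V3]] +
   ereal_sup [set z | exists x y : V3, x != y /\
                z = (enorm (u x - u y)%R / enorm (x - y)%R `^ s)%:E])%E.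

(* The H^s norm, through the Fourier coefficients of u: the two squared integrals
   below add up to the square modulus of the k-th coefficient of u_i. *)
Definition freq (k : 'rV[int]_3) : V3 := \row_(i < 3) (2 * pi * (k 0 i)%:~R).

Definition Hnorm (s : R) (u : V3 -> V3) : \bar R :=
  ((\esum_(k in [set: 'rV[int]_3])
      (((1 + dot (freq k) (freq k)) `^ s)%:E *
       \sum_(i < 3)
         ((\int[torus]_p (u (pt p) 0 i * cos (dot (freq k) (pt p)))%:E) ^+ 2 +
          (\int[torus]_p (u (pt p) 0 i * sin (dot (freq k) (pt p)))%:E) ^+ 2)))
   `^ 2^-1)%E.

Definition L2field (u : V3 -> V3) : Prop :=
  [/\ Z3_periodic u, torus_measurable u & (L2norm u < +oo)%E].

Definition ae_eq_torus (u w : V3 -> V3) : Prop :=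
  {ae torus, forall p, u (pt p) = w (pt p)}.

Definition divfree (u : V3 -> V3) : Prop :=
  forall phi : V3 -> R, smooth phi -> Z3_periodic phi ->
    (\int[torus]_p (\sum_(i < 3) u (pt p) 0 i * pderiv i phi (pt p))%:E)%E = 0%E.

(* G i j is the weak derivative of u_i in the direction j. *)
Definition weak_gradient (u : V3 -> V3) (G : V3 -> 'M[R]_3) : Prop :=
  Z3_periodic G /\
  forall i j : 'I_3,
    torus.-integrable setT (fun p => (G (pt p) i j)%:E) /\
    forall phi : V3 -> R, smooth phi -> Z3_periodic phi ->
      (\int[torus]_p (u (pt p) 0 i * pderiv j phi (pt p))%:E =
       - \int[torus]_p (G (pt p) i j * phi (pt p))%:E)%E.

(* The square of the L^2 norm of the gradient. All weak gradients of u agree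
   almost everywhere, so this infimum runs over at most one value, and it is +oo
   when u has no weak gradient. *)
Definition dirichlet (u : V3 -> V3) : \bar R :=
  ereal_inf
    [set (\int[torus]_p (\sum_(i < 3) \sum_(j < 3) (G (pt p) i j) ^+ 2)%:E)%E
    | G in weak_gradient u].

(* The integral over the unit sphere against the surface measure, in spherical
   coordinates. *)
Definition sph (theta phi : R) : V3 :=
  vec3 (sin theta * cos phi) (sin theta * sin phi) (cos theta).

Definition sphere_integral (g : V3 -> \bar R) : \bar R :=
  (\int[@lebesgue_measure R]_(theta in `[0%R, pi])
     ((sin theta)%:E *
      \int[@lebesgue_measure R]_(phi in `[0%R, (2 * pi)%R]) g (sph theta phi)))%E.

End space.
Arguments V3 : clear implicits.

Section space_time.
Context {R : realType}.
Implicit Types (v f : R -> V3 R -> V3 R) (v_in : V3 R -> V3 R) (nu t : R).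

Definition spacetime_field v : Prop :=
  (forall t, 0 <= t <= 1 -> Z3_periodic (v t)) /\
  forall i, measurable_fun (@time_space R)
              (fun tp : R * (R * R * R) => v tp.1 (pt tp.2) 0 i).

(* Smoothness on the closed set [0, 1] x R^3: each component is the restriction
   of a smooth function of R x R^3. *)
Definition smooth_spacetime v : Prop :=
  forall i : 'I_3, exists2 F : (R^o * V3 R)%type -> R, smooth F &
    forall t x, 0 <= t <= 1 -> F (t, x) = v t x 0 i.

(* The norm of L^p(0, 1; X), where N is the norm of X. *)
Definition Lt (p : \bar R) (N : (V3 R -> V3 R) -> \bar R) v : \bar R :=
  ('N[unit_time]_p[(fun t => N (v t))])%E.

(* The weak form of
     d_t v + v . grad p + grad p = nu Delta v + f
   integrated over [0, t] and tested against psi. *)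
Definition weak_equation nu v_in f v (p : R -> V3 R -> R) t
    (psi : V3 R -> V3 R) : Prop :=
  (inner (v t) psi = inner v_in psi +
     \int[@lebesgue_measure R]_(s in `[0%R, t]) \int[torus]_y
       (let x := pt y in
        (\sum_(i < 3) \sum_(j < 3)
            v s x 0 i * v s x 0 j * pderiv j (component psi i) x) +
        p s x * (\sum_(i < 3) pderiv i (component psi i) x) +
        nu * (\sum_(i < 3) \sum_(j < 3)
            v s x 0 i * pderiv j (pderiv j (component psi i)) x) +
        dot (f s x) (psi x))%R%:E)%E.

Record pressure (p : R -> V3 R -> R) : Prop := {
  pressure_periodic : forall t, 0 <= t <= 1 -> Z3_periodic (p t) ;
  pressure_measurable :
    measurable_fun (@time_space R)
      (fun tp : R * (R * R * R) => p tp.1 (pt tp.2)) ;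
  pressure_L1 :
    (\int[unit_time]_t \int[torus]_y `|p t (pt y)|%:E < +oo)%E }.

(* Weak solutions of Navier-Stokes, and of Euler when nu = 0. *)
Record weak_solution nu v_in f v : Prop := {
  ws_v_in : L2field v_in /\ divfree v_in ;
  ws_f : spacetime_field f /\ (Lt 1%:E L2norm f < +oo)%E ;
  ws_v : spacetime_field v /\ (Lt 2%:E L2norm v < +oo)%E ;
  ws_divfree : forall t, 0 <= t <= 1 -> divfree (v t) ;
  ws_init : ae_eq_torus (v 0) v_in ;
  ws_eq : exists2 p, pressure p &
    forall t psi, 0 <= t <= 1 -> smooth_field psi -> Z3_periodic psi ->
      weak_equation nu v_in f v p t psi }.

Definition energy_lhs nu v t : \bar R :=
  (L2norm (v t) ^+ 2 +
   (2 * nu)%:E * \int[@lebesgue_measure R]_(s in `[0%R, t]) dirichlet (v s))%E.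

Definition energy_rhs v_in f v t : \bar R :=
  (L2norm v_in ^+ 2 +
   2%:E * \int[@lebesgue_measure R]_(s in `[0%R, t]) inner (f s) (v s))%E.

Record leray_hopf nu v_in f v : Prop := {
  lh_weak : weak_solution nu v_in f v ;
  lh_LinftyL2 : (Lt +oo L2norm v < +oo)%E ;
  lh_L2H1 : (Lt 2%:E (Hnorm 1) v < +oo)%E ;
  lh_L2 : forall t, 0 <= t <= 1 -> L2field (v t) ;
  lh_weakly_continuous : forall w, L2field w ->
    {within `[0, 1], continuous (fun t => inner (v t) w)} ;
  lh_energy : forall t, 0 < t <= 1 ->
    (energy_lhs nu v t <= energy_rhs v_in f v t)%E }.

Definition increment (h : V3 R) (u : V3 R -> V3 R) : V3 R -> V3 R :=
  fun x => u (x + h) - u x.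

(* The structure functions of a field at a fixed time. *)
Definition S3 (u : V3 R -> V3 R) (l : R) : \bar R :=
  (((4 * pi)^-1)%:E * sphere_integral (fun n =>
     \int[torus]_p (enorm (increment (l *: n) u (pt p)) ^+ 3)%:E))%E.

Definition S0 (u : V3 R -> V3 R) (l : R) : \bar R :=
  (((4 * pi)^-1)%:E * sphere_integral (fun n =>
     \int[torus]_p (enorm (increment (l *: n) u (pt p)) ^+ 2 *
                    dot (increment (l *: n) u (pt p)) n)%:E))%E.

Definition epsilon f v (l : R) : \bar R :=
  ((2^-1)%:E * L2norm (v 0%R) ^+ 2
   - (3 / (8 * pi * l ^+ 3))%:E *
     \int[@lebesgue_measure R]_(tau in `[0%R, l])
       ((tau ^+ 2)%:E *
        sphere_integral (fun n =>
          inner (v 1%R) (fun x => v 1%R (x + tau *: n)%R)))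
   + \int[@lebesgue_measure R]_(r in `[0%R, 1%R]) inner (f r) (v r))%E.

End space_time.

Section families.
Context {R : realType}.
Implicit Types (v f : R -> R -> V3 R -> V3 R) (v_in : V3 R -> V3 R).

(* The properties of the family of Brue, Colombo, Crippa, De Lellis and Sorella;
   the first argument of f and v is the viscosity, the value 0 of which gives the
   inviscid limit. Since only the existence of the exponent sigma of the
   convergence of the forces matters, and since the spaces L^(1+sigma) C^sigma
   decrease with sigma, it can be taken less than 1. *)
Record BCCDS (alpha : R) v_in f v : Prop := {
  bccds_v_in : [/\ smooth_field v_in, Z3_periodic v_in, divfree v_in &
    forall i, (\int[torus]_p (v_in (pt p) 0 i)%:E)%E = 0%E] ;
  bccds_f : forall nu : R, 0 <= nu <= 1 ->
    smooth_spacetime (f nu) /\ spacetime_field (f nu) ;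
  bccds_leray_hopf : forall nu : R, 0 < nu < 1 ->
    leray_hopf nu v_in (f nu) (v nu) ;
  bccds_unique : forall (nu : R) w, 0 < nu < 1 -> leray_hopf nu v_in (f nu) w ->
    forall t : R, 0 <= t <= 1 -> ae_eq_torus (w t) (v nu t) ;
  bccds_bound :
    (ereal_sup [set Lt 3%:E (Cnorm alpha) (v nu) + Lt +oo Linftynorm (v nu)
               | nu in `]0%R, 1%R[] < +oo)%E ;
  bccds_anomalous_dissipation :
    ((4^-1)%:E < limf_esup (fun nu : R => nu%:E *
       \int[@lebesgue_measure R]_(t in `[0%R, 1%R]) dirichlet (v nu t))
       (0%R : R)^'+)%E ;
  bccds_energy_equality : forall nu t : R, 0 < nu < 1 -> 0 < t <= 1 ->
    energy_lhs nu (v nu) t = energy_rhs v_in (f nu) (v nu) t ;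
  bccds_force_limit : exists2 sigma : R, 0 < sigma < 1 &
    Lt (1 + sigma)%:E (Cnorm sigma) (fun t x => f nu t x - f 0 t x)
      @[nu --> 0^'+] --> 0%E ;
  bccds_solution_limit :
    Lt 2%:E L2norm (fun t x => v nu t x - v 0 t x) @[nu --> 0^'+] --> 0%E ;
  bccds_euler : weak_solution 0 v_in (f 0) (v 0) }.

(* l_D = nu ^ K is a dissipation scale of the family. *)
Record dissipation_scale f v (K : R) : Prop := {
  ds_bound : exists sigma a q : R,
    [/\ 0 < sigma, 0 < a < 1, 1 <= q <= 2,
        (ereal_sup [set Lt +oo L2norm (v nu) + Lt q%:E (Hnorm a) (v nu)
                        + Lt (1 + sigma)%:E L2norm (f nu)
                   | nu in `]0%R, 1%R[] < +oo)%E
      & 0 < K < 1 / (2 - a * q)] ;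
  ds_limit :
    limf_esup (fun nu : R => ereal_sup
        [set `|\int[@lebesgue_measure R]_(r in `[0%R, 1%R])
                  (S0 (v nu r) l * (l^-1)%:E)
               + (4 / 3)%:E * epsilon (f nu) (v nu) l|%E
        | l in `[nu `^ K, l_I]]) 0^'+
      @[l_I --> (0 : R)^'+] --> 0%E }.

(* log (int_0^1 S_3(r, l) dr) / log l, extended-real valued: the logarithm of a
   vanishing integral is -oo. *)
Definition S3_exponent (u : R -> V3 R -> V3 R) (l : R) : \bar R :=
  (lne (\int[@lebesgue_measure R]_(r in `[0%R, 1%R]) S3 (u r) l)
   * ((ln l)^-1)%:E)%E.

Definition zeta3 (K : R) v : \bar R :=
  limf_einf (fun l_I : R => ereal_inf
    [set ereal_inf [set S3_exponent (v nu) l | l in `[nu `^ K, l_I]]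
    | nu in `]0, 1[]) 0^'+.

Definition zeta3_bar (K : R) v : \bar R :=
  limf_esup (fun l_I : R =>
    limf_einf (fun nu : R =>
      ereal_sup [set S3_exponent (v nu) l | l in `[nu `^ K, l_I]]) 0^'+) 0^'+.

End families.

(* Main.v *)
From HB Require Import structures.
Require Import Defs.
From mathcomp Require Import all_boot all_order all_algebra.
From mathcomp Require Import all_classical all_reals all_analysis.
From mathcomp Require Import measurable_realfun.
From mathcomp Require Import ring lra.

Import Order.TTheory GRing.Theory Num.Theory.
Import numFieldNormedType.Exports.

Local Open Scope ring_scope.
Local Open Scope classical_set_scope.

(** The lower bound [3 alpha <= zeta3] is Hoelder continuity: an increment over a
    distance [l] is at most [l ^ alpha] times the [C^alpha] norm, so that the time
    integral of [S3] at scale [l] is at most [C l ^ (3 alpha)], with [C]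
    independent of [nu] (lemma [integral_S3_le]). Dividing logarithms by
    [ln l < 0] turns this into a lower bound of the exponent, up to the error
    [ln C / ln l], which vanishes as [l] tends to 0.

    The upper bound [zeta3_bar <= 1] comes from the 4/3 law, which holds down
    to the dissipation scale. Pointwise [|S0| <= S3], hence a lower bound of the
    size of [int S0 / l] bounds [int S3] from below by a multiple of [l], and
    the exponent from above by 1 plus a vanishing error. By the 4/3 law,
    [int S0 / l] is close to [- 4/3 epsilon], uniformly in [l] between [nu ^ K]
    and [l_I], so it suffices to bound [epsilon] from below. There the
    correlation of [v_nu(1)] with its translates is at most [|v_nu(1)|^2], by the
    Cauchy-Schwarz inequality and the invariance under translations of the
    integral over the torus; the energy equality then gives
    [epsilon >= nu int |grad v_nu|^2] at every scale [l]
    (lemma [dissipation_le_epsilon]), and anomalous dissipation makes the right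
    side larger than 1/4 for arbitrarily small [nu]. Since [zeta3_bar] has a lower
    limit in [nu], such a sequence of viscosities is enough.

    The middle inequality only says that the scale [l = l_I] is admissible once
    [nu] is small, which holds because [K > 0].

    The integrands are compared without a discussion of their measurability: the
    integral of an arbitrary nonnegative function is the supremum of those of the
    simple functions below it, hence it is monotone, and a constant factor can be
    taken out of an upper bound. *)

(** * Integrals of arbitrary functions *)

Section arbitrary_integrands.
Local Open Scope ereal_scope.
Context {d} {T : measurableType d} {R : realType}.
Variable mu : {measure set T -> \bar R}.
Implicit Types (D : set T) (f g : T -> \bar R).
Import HBNNSimple.

(** The simple functions below [f] are also below [g], and the integral is a
    supremum over them. *)
Lemma ge0_le_integral_arbitrary D f g :
  (forall x, D x -> 0 <= f x) -> (forall x, D x -> f x <= g x) ->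
  \int[mu]_(x in D) f x <= \int[mu]_(x in D) g x.
Proof.
move=> f0 fg; have g0 x : D x -> 0 <= g x.
  by move=> Dx; rewrite (le_trans (f0 x Dx)) ?fg.
rewrite !ge0_integralE//; apply: le_ereal_sup => _ [h hf <-]; exists h => // x.
rewrite (le_trans (hf x))// !patchE; case: ifPn => // /set_mem; exact: fg.
Qed.

(** The integral is that of the positive part minus that of the negative part,
    and each of these lies between 0 and the integral of [g]. *)
Lemma le_abse_integral_arbitrary D f g :
  (forall x, D x -> `|f x| <= g x) ->
  `|\int[mu]_(x in D) f x| <= \int[mu]_(x in D) g x.
Proof.
move=> fg; rewrite integralE.
have p0 x : 0 <= f^\+ x by exact: funepos_ge0.
have n0 x : 0 <= f^\- x by exact: funeneg_ge0.
have pg : \int[mu]_(x in D) f^\+ x <= \int[mu]_(x in D) g x.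
  apply: ge0_le_integral_arbitrary => // x Dx; rewrite (le_trans _ (fg x Dx))//.
  by rewrite -[leRHS]/((abse \o f) x) fune_abse leeDl.
have ng : \int[mu]_(x in D) f^\- x <= \int[mu]_(x in D) g x.
  apply: ge0_le_integral_arbitrary => // x Dx; rewrite (le_trans _ (fg x Dx))//.
  by rewrite -[leRHS]/((abse \o f) x) fune_abse leeDr.
have ip : 0 <= \int[mu]_(x in D) f^\+ x by exact: integral_ge0.
have im : 0 <= \int[mu]_(x in D) f^\- x by exact: integral_ge0.
move: ip im pg ng; case: (\int[mu]_(x in D) f^\+ x) => [p| |]//;
  case: (\int[mu]_(x in D) f^\- x) => [m| |]//;
  case: (\int[mu]_(x in D) g x) => [G| |]// ip im pg ng; rewrite ?leey//=.
by move: ip im pg ng; rewrite !lee_fin ler_norml => *; lra.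
Qed.

(** Dividing by [c] a simple function below [c f] gives a simple function below
    [f]. This half of homogeneity is the direction in which constants are pulled
    out of the upper bounds. *)
Lemma ge0_integralZl_le D f (c : R) : (0 <= c)%R ->
  (forall x, D x -> 0 <= f x) ->
  \int[mu]_(x in D) (c%:E * f x) <= c%:E * \int[mu]_(x in D) f x.
Proof.
rewrite le_eqVlt => /predU1P[<- f0|c0 f0].
  by under eq_integral do rewrite mul0e; rewrite integral0 mul0e.
rewrite !ge0_integralE//; last by move=> x Dx; rewrite mule_ge0 ?lee_fin ?f0 ?ltW.
apply: ge_ereal_sup => _ [h hf <-].
have ci0 : (0 <= c^-1)%R by rewrite invr_ge0 ltW.
have -> : sintegral mu h = c%:E * sintegral mu (scale_nnsfun h ci0).
  by rewrite sintegralrM muleA -EFinM divff ?gt_eqF// mul1e.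
rewrite lee_pmul2l ?lte_fin//; apply: ereal_sup_ubound.
exists (scale_nnsfun h ci0) => //= x; move: (hf x).
rewrite !patchE EFinM; case: ifPn => _ hx.
  by rewrite lee_pdivrMl.
by rewrite mule_ge0_le0 ?lee_fin.
Qed.

End arbitrary_integrands.

Section restricted_measure.
Local Open Scope ereal_scope.
Context {d} {T : measurableType d} {R : realType}.
Variable mu : {measure set T -> \bar R}.
Implicit Types (D : set T) (f : T -> \bar R).

(** Compares the two ways of integrating over a subset, by restricting the
    domain or the measure, when [f] is arbitrary. *)
Lemma integral_le_mrestr D (mD : measurable D) f : (forall x, 0 <= f x) ->
  \int[mu]_(x in D) f x <= \int[mrestr mu mD]_x f x.
Proof.
move=> f0; rewrite (eq_measure_integral (mrestr mu mD)); last first.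
  by move=> A mA AD; rewrite /= /mrestr setIidl.
rewrite integral_mkcond; apply: ge0_le_integral_arbitrary => x _.
  by rewrite patchE; case: ifPn.
by rewrite patchE; case: ifPn.
Qed.

Lemma ge0_integral_mrestr D (mD : measurable D) f : (forall x, 0 <= f x) ->
  measurable_fun setT f ->
  \int[mrestr mu mD]_x f x = \int[mu]_(x in D) f x.
Proof.
move=> f0 mf; rewrite [RHS](eq_measure_integral (mrestr mu mD)); last first.
  by move=> A mA AD; rewrite /= /mrestr setIidl.
rewrite [LHS](ge0_negligible_integral (measurableC mD))//.
  by rewrite setDE setCK setTI.
by rewrite /= /mrestr setICl measure0.
Qed.

End restricted_measure.

(** * Euclidean vectors and integration over the sphere *)

Section euclidean.
Context {R : realType}.
Implicit Types (x y n : V3 R) (u : V3 R -> V3 R) (l : R).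

Lemma dotE x y : dot x y = x 0 0 * y 0 0 + x 0 1 * y 0 1 + x 0 2%:R * y 0 2%:R.
Proof.
rewrite /dot !big_ord_recl big_ord0 addr0 addrA.
by congr (_ * _ + _ * _ + _ * _); congr (_ _ _); apply/val_inj.
Qed.

Lemma dot_ge0 x : 0 <= dot x x.
Proof. by apply: sumr_ge0 => i _; rewrite -expr2 sqr_ge0. Qed.

Lemma enorm_ge0 x : 0 <= enorm x.
Proof. exact: sqrtr_ge0. Qed.

Lemma sqr_enorm x : enorm x ^+ 2 = dot x x.
Proof. by rewrite sqr_sqrtr ?dot_ge0. Qed.

Lemma enormZ l x : enorm (l *: x) = `|l| * enorm x.
Proof.
rewrite /enorm -sqrtr_sqr -sqrtrM ?sqr_ge0//; congr Num.sqrt.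
by rewrite !dotE !mxE; ring.
Qed.

(** Cauchy-Schwarz, from Lagrange's identity. *)
Lemma normr_dot_le x y : `|dot x y| <= enorm x * enorm y.
Proof.
rewrite -sqrtrM ?dot_ge0// -sqrtr_sqr ler_wsqrtr// !dotE.
rewrite -subr_ge0 (_ : _ - _ = (x 0 0 * y 0 1 - x 0 1 * y 0 0) ^+ 2
  + (x 0 0 * y 0 2%:R - x 0 2%:R * y 0 0) ^+ 2
  + (x 0 1 * y 0 2%:R - x 0 2%:R * y 0 1) ^+ 2); last by ring.
by rewrite !addr_ge0 ?sqr_ge0.
Qed.

Lemma normr_dot_le_mean x y : `|dot x y| <= 2^-1 * enorm x ^+ 2 + 2^-1 * enorm y ^+ 2.
Proof.
apply: le_trans (normr_dot_le x y) _; rewrite -subr_ge0.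
rewrite (_ : _ - _ = 2^-1 * (enorm x - enorm y) ^+ 2); last by field.
by rewrite mulr_ge0 ?sqr_ge0.
Qed.

Lemma enorm_sph (theta phi : R) : enorm (sph theta phi) = 1.
Proof.
rewrite /enorm dotE !mxE/= (_ : _ + _ = 1) ?sqrtr1//.
rewrite -[RHS](cos2Dsin2 theta) -[sin theta ^+ 2 in RHS]mulr1 -(cos2Dsin2 phi).
ring.
Qed.

End euclidean.

Section sphere.
Context {R : realType}.
Implicit Types (g h : V3 R -> \bar R).
Local Open Scope ereal_scope.
Local Notation mu := (@lebesgue_measure R).

Lemma integral_sin : \int[mu]_(x in `[0%R, pi]) (sin x)%:E = 2%:E.
Proof.
rewrite (@continuous_FTC2 _ _ (fun x => - cos x)%R).
- by rewrite cospi cos0 -EFinB; congr EFin; lra.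
- exact: pi_gt0.
- apply: continuous_subspaceT; exact: continuous_sin.
- split.
  + move=> x _; exact: derivableN.
  + by apply: cvg_at_right_filter; apply: cvgN; exact: continuous_cos.
  + by apply: cvg_at_left_filter; apply: cvgN; exact: continuous_cos.
- by move=> x _; rewrite derive1E deriveN// derive_val opprK.
Qed.

Lemma sphere_integral_cst (c : R) : (0 <= c)%R ->
  sphere_integral (cst c%:E) = (4 * pi * c)%:E.
Proof.
move=> c0; rewrite /sphere_integral.
have p0 := @pi_ge0 R.
rewrite (eq_integral
  (fun x : measurableTypeR R => (2 * pi * c)%:E * (sin x)%:E)); last first.
  move=> x _; rewrite integral_cst//= lebesgue_measure_itv/= lte_fin.
  rewrite mulr_gt0 ?pi_gt0//= muleC; congr (_ * _).
  by rewrite -EFinB subr0 -EFinM mulrC.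
rewrite ge0_integralZl_EFin//.
- by rewrite integral_sin -EFinM; congr EFin; ring.
- by move=> x /=; rewrite in_itv/= => xpi; rewrite lee_fin sin_ge0_pi.
- apply/measurable_EFinP; apply: measurable_funTS.
  by apply: continuous_measurable_fun; exact: continuous_sin.
- by rewrite !mulr_ge0.
Qed.

(** The Jacobian [sin theta] of the spherical coordinates is nonnegative on
    [[0, pi]], so that pointwise bounds pass to the integral. *)
Lemma abse_sphere_integral_le g h :
  (forall n, enorm n = 1%R -> `|g n| <= h n) ->
  `|sphere_integral g| <= sphere_integral h.
Proof.
move=> gh; apply: le_abse_integral_arbitrary => theta /=; rewrite in_itv/= => tpi.
have s0 : (0 <= sin theta)%R by rewrite sin_ge0_pi.
rewrite abseM gee0_abs ?lee_fin// lee_wpmul2l ?lee_fin//.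
apply: le_abse_integral_arbitrary => phi _; apply: gh; exact: enorm_sph.
Qed.

End sphere.

(** * Structure functions *)

Section structure_functions.
Context {R : realType}.
Implicit Types (u : V3 R -> V3 R) (w : R -> V3 R -> V3 R) (l s : R).
Local Open Scope ereal_scope.

Lemma torus_setT : (@torus R) setT = 1.
Proof.
pose la := @lebesgue_measure R; pose I : set (measurableTypeR R) := `[0%R, 1%R]%classic.
transitivity (((la \x la) \x la) ((I `*` I) `*` I)).
  by rewrite /torus /mrestr setTI.
have mI : measurable I by exact: measurable_itv.
rewrite product_measure1E//; last by apply: measurableX.
rewrite [X in X * _](_ : _ = la I * la I); last exact: product_measure1E.
have I1 : la I = 1 by rewrite /la lebesgue_measure_itv/= lte_fin ltr01 oppr0 adde0.
rewrite I1 mul1e; exact: etrans (mul1e _) I1.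
Qed.

Lemma S3_ge0 u l : 0 <= S3 u l.
Proof.
rewrite mule_ge0 ?lee_fin ?invr_ge0 ?mulr_ge0 ?pi_ge0//.
apply: integral_ge0 => theta /=; rewrite in_itv/= => tpi.
rewrite mule_ge0 ?lee_fin ?sin_ge0_pi//; apply: integral_ge0 => phi _.
by apply: integral_ge0 => p _; rewrite lee_fin exprn_ge0 ?enorm_ge0.
Qed.

(** [S0] differs from [S3] in that one factor [|delta v|] is replaced with the
    longitudinal component of [delta v]. *)
Lemma abse_S0_le u l : `|S0 u l| <= S3 u l.
Proof.
have c0 : (0 <= (4 * pi)^-1 :> R)%R by rewrite invr_ge0 mulr_ge0 ?pi_ge0.
rewrite abseM gee0_abs ?lee_fin// lee_wpmul2l ?lee_fin//.
apply: abse_sphere_integral_le => n n1.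
apply: le_abse_integral_arbitrary => p _.
rewrite lee_fin normrM normrX (ger0_norm (enorm_ge0 _)) [leRHS]exprSr.
rewrite ler_wpM2l ?exprn_ge0 ?enorm_ge0//.
by rewrite (le_trans (normr_dot_le _ _))// n1 mulr1.
Qed.

Lemma Cnorm_ge0 s u : 0 <= Cnorm s u.
Proof.
rewrite adde_ge0//.
  apply: le_trans (ereal_sup_ubound _); last by exists 0%R.
  by rewrite lee_fin enorm_ge0.
(* The second supremum is over a nonempty set of nonnegative numbers. *)
have x01 : (delta_mx 0 0 != 0 :> V3 R)%R.
  by apply/eqP => /matrixP/(_ 0 0)%R; rewrite !mxE/=; apply/eqP; rewrite oner_eq0.
apply: le_trans (ereal_sup_ubound _); last by exists (delta_mx 0%R 0%R), 0%R; split.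
by rewrite lee_fin divr_ge0 ?enorm_ge0 ?powR_ge0.
Qed.

Lemma enorm_increment_le s u l n x : (0 < l)%R -> enorm n = 1%R ->
  (enorm (increment (l *: n) u x))%:E <= Cnorm s u * (l `^ s)%:E.
Proof.
move=> l0 n1.
have ln : enorm (l *: n) = l by rewrite enormZ n1 mulr1 gtr0_norm.
(* The quotient in [Cnorm] is over pairs of distinct points. *)
have xn : (x + l *: n != x)%R.
  rewrite -subr_eq0 addrAC subrr add0r; apply: contraTneq l0 => ln0.
  by rewrite -ln ln0 /enorm dotE !mxE !mul0r !addr0 sqrtr0 ltxx.
rewrite -lee_pdivrMr ?powR_gt0//; rewrite /Cnorm.
set B := (X in _ <= _ + ereal_sup X); apply: (@le_trans _ _ (ereal_sup B)).
  apply: ereal_sup_ubound; exists (x + l *: n)%R, x; split=> //.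
  by rewrite -EFinM (addrAC x) subrr add0r ln.
rewrite leeDr//; apply: le_trans (ereal_sup_ubound _); last by exists 0%R.
by rewrite lee_fin enorm_ge0.
Qed.

(** The norm can be infinite, in which case the right side is too, since
    [l > 0]. *)
Lemma S3_le_Cnorm s u l : (0 < l)%R ->
  S3 u l <= (l `^ (3 * s))%:E * Cnorm s u `^ 3.
Proof.
move=> l0; have ls0 : (0 < l `^ s)%R by exact: powR_gt0.
case E : (Cnorm s u) => [c| |].
- have c0 : (0 <= c)%R by rewrite -lee_fin -E Cnorm_ge0.
  pose M := ((l `^ s * c) ^+ 3)%R.
  have -> : (l `^ (3 * s))%:E * c%:E `^ 3 = M%:E.
    rewrite poweR_EFin -EFinM /M exprMn (powR_mulrn 3)//.
    by rewrite (mulrC 3%R) powRrM powR_mulrn ?ltW.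
  have M0 : (0 <= M)%R by rewrite exprn_ge0// mulr_ge0// ltW.
  have p0 : (0 < 4 * pi :> R)%R by rewrite mulr_gt0 ?pi_gt0.
  rewrite lee_pdivrMl// -EFinM -sphere_integral_cst//.
  apply: le_trans (lee_abs _) _; apply: abse_sphere_integral_le => n n1.
  apply: (@le_trans _ _ (\int[torus]_p (cst M%:E p))); last first.
    by rewrite integral_cst// [X in _ * X](_ : _ = 1) ?mule1//; exact: torus_setT.
  apply: le_abse_integral_arbitrary => p _.
  rewrite lee_fin normrX ger0_norm ?enorm_ge0//.
  apply: lerXn2r; rewrite ?nnegrE ?enorm_ge0 ?mulr_ge0 ?powR_ge0//.
  rewrite -lee_fin mulrC EFinM -E.
  exact: enorm_increment_le.
- by rewrite poweRyr ?gt0_muley ?lte_fin ?powR_gt0 ?leey ?pnatr_eq0.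
- by have := Cnorm_ge0 s u; rewrite E.
Qed.

Lemma integral_S3_le s w l : (0 < l)%R ->
  \int[@lebesgue_measure R]_(r in `[0%R, 1%R]) S3 (w r) l <=
  (l `^ (3 * s))%:E * Lt 3%:E (Cnorm s) w `^ 3.
Proof.
move=> l0; apply: (@le_trans _ _ (\int[@lebesgue_measure R]_(r in `[0%R, 1%R])
  ((l `^ (3 * s))%:E * Cnorm s (w r) `^ 3))).
  by apply: ge0_le_integral_arbitrary => r _; [exact: S3_ge0|exact: S3_le_Cnorm].
apply: le_trans (ge0_integralZl_le _ _ _ _ _ _) _.
- exact: powR_ge0.
- by move=> r _; exact: poweR_ge0.
rewrite lee_wpmul2l ?lee_fin ?powR_ge0// /Lt poweR_Lnorm ?pnatr_eq0//.
apply: (@le_trans _ _ (\int[unit_time]_r (Cnorm s (w r) `^ 3))).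
  by apply: integral_le_mrestr => r; exact: poweR_ge0.
by apply: ge0_le_integral_arbitrary => r _; rewrite ?poweR_ge0// gee0_abs ?Cnorm_ge0.
Qed.

Lemma abse_integral_S0_le w l : (0 < l)%R ->
  `|\int[@lebesgue_measure R]_(r in `[0%R, 1%R]) (S0 (w r) l * (l^-1)%:E)| <=
  (l^-1)%:E * \int[@lebesgue_measure R]_(r in `[0%R, 1%R]) S3 (w r) l.
Proof.
move=> l0; have li0 : (0 <= l^-1)%R by rewrite invr_ge0 ltW.
apply: le_trans (ge0_integralZl_le _ _ _ _ _ _); rewrite //; last first.
  by move=> r _; exact: S3_ge0.
apply: le_abse_integral_arbitrary => r _.
by rewrite abseM muleC gee0_abs ?lee_fin// lee_wpmul2l ?lee_fin// abse_S0_le.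
Qed.

End structure_functions.

(** * Translations and product measures *)

Section translate.
Context {R : realType}.
Local Open Scope ereal_scope.
Local Notation mu := (@lebesgue_measure R).
Implicit Types (g : measurableTypeR R -> \bar R) (a : R).

Definition translate a (x : measurableTypeR R) : measurableTypeR R := (x + a)%R.

Lemma measurable_translate a : measurable_fun setT (translate a).
Proof. exact: measurable_funD. Qed.

(** Translates of half-open intervals have the same length, and these intervals
    determine the Lebesgue measure. *)
Lemma pushforward_translate a (A : set (measurableTypeR R)) : measurable A ->
  pushforward mu (translate a) A = mu A.
Proof.
have ms := measurable_translate a.
pose sa : {mfun measurableTypeR R >-> measurableTypeR R} :=
  HB.pack (translate a) (isMeasurableFun.Build _ _ _ _ _ ms).
move=> mA; apply/esym.
apply: (@lebesgue_measure_unique _ (pushforward mu sa)) => //= _ [[b c]] _ <-.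
rewrite /pushforward/= (_ : _ @^-1` _ = `](b - a)%R, (c - a)%R]%classic).
  rewrite !lebesgue_measure_itv/= !lte_fin ltrD2r; case: ifP => // _.
  by rewrite -!EFinB; congr EFin; ring.
by apply/seteqP; split=> x /=; rewrite !in_itv/= /translate ltrBlDr lerBrDr.
Qed.

Lemma ge0_integral_translate a g p q : measurable_fun setT g -> (forall x, 0 <= g x) ->
  \int[mu]_(x in `[p, q[) g (x + a)%R = \int[mu]_(x in `[(p + a)%R, (q + a)%R[) g x.
Proof.
move=> mg g0.
have ms := measurable_translate a.
pose sa : {mfun measurableTypeR R >-> measurableTypeR R} :=
  HB.pack (translate a) (isMeasurableFun.Build _ _ _ _ _ ms).
rewrite (_ : `[p, q[%classic = sa @^-1` `[(p + a)%R, (q + a)%R[%classic); last first.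
  by apply/seteqP; split=> x /=; rewrite !in_itv/= /translate lerD2r ltrD2r.
rewrite -(@ge0_integral_pushforward _ _ _ _ _ sa _ mu _ g)//.
  by apply: eq_measure_integral => A mA _; exact: pushforward_translate.
exact: measurable_funTS.
Qed.

Lemma periodic_int (T : Type) (h : R -> T) (x : R) (m : int) :
  (forall x, h (x + 1)%R = h x) -> h (x + m%:~R)%R = h x.
Proof.
move=> h1; have hn y n : h (y + n%:R)%R = h y.
  by elim: n y => [|n IH] y; rewrite ?addr0// -natr1 addrA h1.
case: m => n; first by rewrite -pmulrn hn.
by rewrite NegzE mulrNz -pmulrn -(hn (x - _)%R n.+1) subrK.
Qed.

(** By periodicity [a] can be replaced with its fractional part [b]; the window
    [[b, 1 + b[] is then cut at 1, and its right part moved back by one period. *)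
Lemma ge0_integral_periodic a g : measurable_fun setT g -> (forall x, 0 <= g x) ->
  (forall x, g (x + 1)%R = g x) ->
  \int[mu]_(x in `[0%R, 1%R]) g (x + a)%R = \int[mu]_(x in `[0%R, 1%R]) g x.
Proof.
move=> mg g0 g1.
have mga b : measurable_fun setT (fun x : measurableTypeR R => g (x + b)%R).
  exact: (measurableT_comp mg (measurable_translate b)).
have half_open (h : measurableTypeR R -> \bar R) :
    measurable_fun setT h -> (forall x, 0 <= h x) ->
    \int[mu]_(x in `[0%R, 1%R]) h x = \int[mu]_(x in `[0%R, 1%R[) h x.
  by move=> mh h0; rewrite integral_itv_bndo_bndc//; exact: measurable_funTS.
rewrite !half_open//.
set b : R := (a - (Num.floor a)%:~R)%R.
have /andP[b0 b1] : (0 <= b < 1)%R.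
  by have /andP[? ?] := mem_rg1_floor a; rewrite /b; apply/andP; split; lra.
transitivity (\int[mu]_(x in `[0%R, 1%R[) g (x + b)%R).
  apply: eq_integral => x _; rewrite -(@periodic_int _ g (x + b)%R (Num.floor a))//.
  by rewrite /b addrA subrK.
rewrite ge0_integral_translate// add0r.
have splitU (p q r : R) : (p <= q)%R -> (q <= r)%R -> \int[mu]_(x in `[p, r[) g x =
    \int[mu]_(x in `[p, q[) g x + \int[mu]_(x in `[q, r[) g x.
  move=> pq qr; rewrite -ge0_integral_setU//.
  - by rewrite -itv_bndbnd_setU// bnd_simp.
  - exact: measurable_funTS.
  - by apply/disj_set2P; apply/seteqP; split=> // x []/=; rewrite !in_itv/= => ? ?; lra.
rewrite (splitU b 1%R)//; [|lra|lra].
rewrite [RHS](splitU 0%R b)//; [|lra].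
rewrite addeC; congr (_ + _).
have := ge0_integral_translate 1%R g 0%R b mg g0; rewrite add0r (addrC b) => <-.
by apply: eq_integral => x _; rewrite g1.
Qed.

End translate.

Section product.
Local Open Scope ereal_scope.
Context {d1 d2 : measure_display} {T1 : measurableType d1} {T2 : measurableType d2}
  {R : realType} (m1 : {sigma_finite_measure set T1 -> \bar R})
  (m2 : {sigma_finite_measure set T2 -> \bar R}) {A : set T1} {B : set T2}
  (mA : measurable A) (mB : measurable B).
Implicit Type F : T1 * T2 -> \bar R.

Lemma integral_setX1 F : measurable_fun setT F -> (forall p, 0 <= F p) ->
  \int[m1 \x m2]_(p in A `*` B) F p =
  \int[m1]_(x in A) \int[m2]_(y in B) F (x, y).
Proof.
move=> mF F0; rewrite integral_mkcond fubini_tonelli1.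
- rewrite [RHS]integral_mkcond; apply: eq_integral => x _.
  rewrite /fubini_F patchE; case: ifPn => [/set_mem Ax|nAx].
    rewrite [RHS]integral_mkcond; apply: eq_integral => y _; rewrite !patchE.
    by rewrite in_setX mem_set.
  apply: integral0_eq => y _; rewrite patchE ifN//.
  by apply: contraNN nAx => /set_mem [/mem_set].
- by apply/(measurable_restrictT _ _).1; [exact: measurableX|exact: measurable_funTS].
- by move=> p; rewrite patchE; case: ifP.
Qed.

Lemma integral_setX2 F : measurable_fun setT F -> (forall p, 0 <= F p) ->
  \int[m1 \x m2]_(p in A `*` B) F p =
  \int[m2]_(y in B) \int[m1]_(x in A) F (x, y).
Proof.
move=> mF F0; rewrite integral_mkcond fubini_tonelli2.
- rewrite [RHS]integral_mkcond; apply: eq_integral => y _.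
  rewrite /fubini_G patchE; case: ifPn => [/set_mem By|nBy].
    rewrite [RHS]integral_mkcond; apply: eq_integral => x _; rewrite !patchE.
    by rewrite in_setX (mem_set By) andbT.
  apply: integral0_eq => x _; rewrite patchE ifN//.
  by apply: contraNN nBy => /set_mem [_ /mem_set].
- by apply/(measurable_restrictT _ _).1; [exact: measurableX|exact: measurable_funTS].
- by move=> p; rewrite patchE; case: ifP.
Qed.

(** Translations of a product act on one factor at a time, so that the
    invariance of an integral can be checked on iterated integrals: the second
    coordinate is treated in one order of integration, the first in the other. *)
Lemma integral_setX_invariant (phi : T1 -> T1) (psi : T2 -> T2) F :
  measurable_fun setT phi -> measurable_fun setT psi ->
  measurable_fun setT F -> (forall p, 0 <= F p) ->
  (forall y, \int[m1]_(x in A) F (phi x, y) = \int[m1]_(x in A) F (x, y)) ->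
  (forall x, \int[m2]_(y in B) F (x, psi y) = \int[m2]_(y in B) F (x, y)) ->
  \int[m1 \x m2]_(p in A `*` B) F (phi p.1, psi p.2) =
  \int[m1 \x m2]_(p in A `*` B) F p.
Proof.
move=> mphi mpsi mF F0 Fphi Fpsi.
have m1p : measurable_fun setT (fun p : T1 * T2 => F (phi p.1, p.2)).
  apply: (measurableT_comp mF); apply: measurable_fun_pair => //.
  exact: measurableT_comp.
have mpp : measurable_fun setT (fun p : T1 * T2 => F (phi p.1, psi p.2)).
  apply: (measurableT_comp mF); apply: measurable_fun_pair => /=;
  exact: measurableT_comp.
transitivity (\int[m1 \x m2]_(p in A `*` B) F (phi p.1, p.2)).
  rewrite (integral_setX1 _ mpp (fun p => F0 _)) (integral_setX1 _ m1p (fun p => F0 _)).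
  by apply: eq_integral => x _ /=; exact: Fpsi.
rewrite (integral_setX2 _ m1p (fun p => F0 _)) (integral_setX2 _ mF F0).
by apply: eq_integral => y _ /=; exact: Fphi.
Qed.

End product.

Section product3.
Local Open Scope ereal_scope.
Context {d1 d2 d3 : measure_display} {T1 : measurableType d1}
  {T2 : measurableType d2} {T3 : measurableType d3} {R : realType}
  (m1 : {sigma_finite_measure set T1 -> \bar R})
  (m2 : {sigma_finite_measure set T2 -> \bar R})
  (m3 : {sigma_finite_measure set T3 -> \bar R})
  {A : set T1} {B : set T2} {C : set T3}
  (mA : measurable A) (mB : measurable B) (mC : measurable C).

Lemma sigma_finite_productP : sigma_finite setT (m1 \x m2).
Proof.
have /sigma_finiteP[F [TF ndF Foo]] := sigma_finiteT m1.
have /sigma_finiteP[G [TG ndG Goo]] := sigma_finiteT m2.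
exists (fun n => F n `*` G n) => [|k].
  rewrite -setXTT TF TG predeqE => -[x y]; split=> [[/= [n _ Fnx] [k _ Gky]]|].
    exists (maxn n k) => //; split.
    - by move: x Fnx; exact/subsetPset/ndF/leq_maxl.
    - by move: y Gky; exact/subsetPset/ndG/leq_maxr.
  by move=> [n _ []/= ? ?]; split; exists n.
have [? ?] := Foo k; have [? ?] := Goo k; split; first exact: measurableX.
by rewrite product_measure1E// lte_mul_pinfty// ge0_fin_numE.
Qed.

(** A name for [m1 \x m2] that carries the structure of a sigma-finite measure,
    as Tonelli's theorem for three factors requires. *)
Definition sigma_finite_product : set (T1 * T2) -> \bar R := m1 \x m2.
HB.instance Definition _ := Measure.on sigma_finite_product.
HB.instance Definition _ := @Measure_isSigmaFinite.Build _ _ _ sigma_finite_product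
  sigma_finite_productP.

Lemma integral_setX3_invariant (phi : T1 -> T1) (psi : T2 -> T2) (chi : T3 -> T3)
    (F : T1 * T2 * T3 -> \bar R) :
  measurable_fun setT phi -> measurable_fun setT psi -> measurable_fun setT chi ->
  measurable_fun setT F -> (forall p, 0 <= F p) ->
  (forall y z, \int[m1]_(x in A) F (phi x, y, z) = \int[m1]_(x in A) F (x, y, z)) ->
  (forall x z, \int[m2]_(y in B) F (x, psi y, z) = \int[m2]_(y in B) F (x, y, z)) ->
  (forall x y, \int[m3]_(z in C) F (x, y, chi z) = \int[m3]_(z in C) F (x, y, z)) ->
  \int[(m1 \x m2) \x m3]_(p in (A `*` B) `*` C) F (phi p.1.1, psi p.1.2, chi p.2) =
  \int[(m1 \x m2) \x m3]_(p in (A `*` B) `*` C) F p.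
Proof.
move=> mphi mpsi mchi mF F0 Fphi Fpsi Fchi.
have mF12 z : measurable_fun setT (fun p : T1 * T2 => F (p, z)).
  by apply: (measurableT_comp mF); exact: measurable_fun_pair.
apply: (integral_setX_invariant sigma_finite_product m3 (measurableX mA mB) mC
  (fun p => (phi p.1, psi p.2)) chi F) => //.
- by apply: measurable_fun_pair; exact: measurableT_comp.
- move=> z; exact: (integral_setX_invariant m1 m2 mA mB phi psi (fun p => F (p, z))).
- by move=> [x y]; exact: Fchi.
Qed.

End product3.

(** * Translation invariance on the torus *)

Section torus.
Context {R : realType}.
Local Notation R3 := (measurableTypeR R * measurableTypeR R * measurableTypeR R)%type.
Local Open Scope ereal_scope.
Implicit Types (u w : V3 R -> V3 R) (h : V3 R) (G : V3 R -> \bar R).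
Local Notation mu := (@lebesgue_measure R).
Local Notation I := (`[0%R, 1%R]%classic : set (measurableTypeR R)).

Lemma ptD (p : R * R * R) h :
  (pt p + h)%R = pt ((p.1.1 + h 0%R 0%R, p.1.2 + h 0%R 1%R), p.2 + h 0%R 2%:R)%R.
Proof.
apply/matrixP => i j; rewrite !mxE (ord1 i).
by case: j => [[|[|[|//]]]] j3 /=; congr (_ + h _ _)%R; apply/val_inj.
Qed.

Lemma measurable_pt_shift h G :
  measurable_fun [set: R3]
    (fun p => G (pt p)) ->
  measurable_fun [set: R3]
    (fun p => G (pt p + h)%R).
Proof.
move=> mG; under eq_fun do rewrite ptD.
have ms := @measurable_translate R.
have mq : measurable_fun setT
    (fun p : R3 =>
    (translate (h 0%R 0%R) p.1.1, translate (h 0%R 1%R) p.1.2,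
     translate (h 0%R 2%:R) p.2)).
  apply: measurable_fun_pair => /=; last exact: (measurableT_comp (ms _)).
  by apply: measurable_fun_pair => /=; apply: (measurableT_comp (ms _));
    exact: measurableT_comp.
exact: (measurableT_comp mG mq).
Qed.

(** Periodicity makes the unit cube as good as any of its translates. *)
Lemma ge0_integral_torus_shift h G : Z3_periodic G -> (forall x, 0 <= G x) ->
  measurable_fun [set: R3]
    (fun p => G (pt p)) ->
  \int[torus]_p G (pt p + h)%R = \int[torus]_p G (pt p).
Proof.
move=> Gper G0 mG; pose F p := G (pt p).
have ms := @measurable_translate R.
have mFs := measurable_pt_shift h G mG.
rewrite (ge0_integral_mrestr _ _ _ _ _ mFs); last by move=> p; exact: G0.
under eq_integral do rewrite ptD -/(F _).
rewrite (ge0_integral_mrestr _ _ _ _ _ mG); last by move=> p; exact: G0.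
have mI : measurable I by exact: measurable_itv.
have mF1 y z : measurable_fun setT (fun x : measurableTypeR R => F (x, y, z)).
  by apply: (measurableT_comp mG); do 2 apply: measurable_fun_pair => //.
have mF2 x z : measurable_fun setT (fun y : measurableTypeR R => F (x, y, z)).
  by apply: (measurableT_comp mG); do 2 apply: measurable_fun_pair => //.
have mF3 x y : measurable_fun setT (fun z : measurableTypeR R => F (x, y, z)).
  by apply: (measurableT_comp mG); apply: measurable_fun_pair => //.
have step (i : 'I_3) (x y z x' y' z' : R) :
    (pt (x, y, z) + delta_mx 0 i)%R = pt (x', y', z') -> F (x', y', z') = F (x, y, z).
  by rewrite /F => <-; exact: Gper.
apply: (integral_setX3_invariant mu mu mu mI mI mI
  (translate (h 0%R 0%R)) (translate (h 0%R 1%R)) (translate (h 0%R 2%:R)) F) => //.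
- by move=> p; exact: G0.
- move=> y z; apply: (ge0_integral_periodic _ (fun x => F (x, y, z))) => //.
    by move=> x; exact: G0.
  by move=> x; apply: (step 0%R); rewrite ptD !mxE/= !addr0.
- move=> x z; apply: (ge0_integral_periodic _ (fun y => F (x, y, z))) => //.
    by move=> y; exact: G0.
  by move=> y; apply: (step 1%R); rewrite ptD !mxE/= !addr0.
- move=> x y; apply: (ge0_integral_periodic _ (fun z => F (x, y, z))) => //.
    by move=> z; exact: G0.
  by move=> z; apply: (step 2%:R); rewrite ptD !mxE/= !addr0.
Qed.

End torus.

(** * Energy and correlations at the final time *)

Section energy.
Context {R : realType}.
Local Notation R3 := (measurableTypeR R * measurableTypeR R * measurableTypeR R)%type.
Local Open Scope ereal_scope.
Implicit Types (u w : V3 R -> V3 R) (h : V3 R) (l : R).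
Local Notation mu := (@lebesgue_measure R).

Lemma sqr_poweR (x : \bar R) : 0 <= x -> x ^+ 2 = x `^ 2.
Proof.
case: x => [r r0| _|//]; last by rewrite poweRyr ?pnatr_eq0// expe2 mulyy.
by rewrite poweR_EFin powR_mulrn// expr2 EFinM expe2.
Qed.

Lemma sqr_L2norm u : L2norm u ^+ 2 = \int[torus]_p (enorm (u (pt p)) ^+ 2)%:E.
Proof.
rewrite sqr_poweR ?Lnorm_ge0// /L2norm poweR_Lnorm ?pnatr_eq0//.
apply: eq_integral => p _.
by rewrite gee0_abs ?lee_fin ?enorm_ge0// poweR_EFin powR_mulrn ?enorm_ge0.
Qed.

Lemma measurable_sqr_enorm u : torus_measurable u ->
  measurable_fun [set: R3]
    (fun p => (enorm (u (pt p)) ^+ 2)%:E).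
Proof.
move=> mu0; apply/measurable_EFinP; under eq_fun do rewrite sqr_enorm dotE.
by apply: measurable_funD; [apply: measurable_funD|]; apply: measurable_funM; exact: mu0.
Qed.

(** Used at time 0, where a weak solution agrees with the initial datum almost
    everywhere only. *)
Lemma eq_ae_L2norm u w : torus_measurable u -> torus_measurable w ->
  ae_eq_torus u w -> L2norm u ^+ 2 = L2norm w ^+ 2.
Proof.
move=> mu0 mw uw; rewrite !sqr_L2norm; apply: ge0_ae_eq_integral => //.
- exact: measurable_sqr_enorm.
- exact: measurable_sqr_enorm.
- by move=> p _; rewrite lee_fin sqr_ge0.
- by move=> p _; rewrite lee_fin sqr_ge0.
- by apply: negligibleS uw => p /=; apply: contra_not => ->.
Qed.

(** Young's inequality under the integral, and the invariance under translations
    of the [L^2] norm, which is where periodicity enters. *)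
Lemma abse_inner_shift_le u h : L2field u ->
  `|inner u (fun x => u (x + h)%R)| <= L2norm u ^+ 2.
Proof.
move=> [per mu0 _]; rewrite sqr_L2norm.
pose G (x : V3 R) := (2^-1 * enorm (u x) ^+ 2)%:E.
have G0 x : 0 <= G x by rewrite lee_fin mulr_ge0 ?sqr_ge0.
have mG : measurable_fun [set: R3]
    (fun p => G (pt p)).
  apply/measurable_EFinP; apply: measurable_funM => //.
  by apply/measurable_EFinP; exact: measurable_sqr_enorm.
have Gper : Z3_periodic G by move=> x i; rewrite /G per.
have mGh : measurable_fun [set: R3]
    (fun p => G (pt p + h)%R).
  exact: measurable_pt_shift.
apply: (@le_trans _ _ (\int[torus]_p (G (pt p) + G (pt p + h)%R))).
  by apply: le_abse_integral_arbitrary => p _; rewrite lee_fin normr_dot_le_mean.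
rewrite ge0_integralD// ge0_integral_torus_shift//.
rewrite -ge0_integralD// le_eqVlt; apply/orP; left; apply/eqP.
by apply: eq_integral => p _; rewrite -EFinD; congr EFin; field.
Qed.

Lemma integral_sqr l : (0 <= l)%R ->
  \int[mu]_(x in `[0%R, l]) (x ^+ 2)%:E = (l ^+ 3 / 3)%:E.
Proof.
rewrite le_eqVlt => /predU1P[<-|l0].
  by rewrite set_itv1 integral_set1 expr0n/= mul0r.
rewrite (@continuous_FTC2 _ _ (fun x => x ^+ 3 / 3)%R)//.
- by rewrite expr0n/= mul0r sube0.
- by apply: continuous_subspaceT => x; exact: exprn_continuous.
- split.
  + move=> x _; exact: derivableM.
  + apply: cvg_at_right_filter; apply: cvgM; [exact: exprn_continuous|exact: cvg_cst].
  + apply: cvg_at_left_filter; apply: cvgM; [exact: exprn_continuous|exact: cvg_cst].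
- move=> x _; rewrite derive1E deriveM// derive_cst scaler0 add0r exp_derive.
  by rewrite /GRing.scale/= mulr1; field.
Qed.

(** The constant is exact: the weight integrates to
    [3 / (8 pi l^3) * (l^3 / 3) * 4 pi = 1/2], so that the kinetic energy at the
    final time, which the energy equality contains with the same factor 1/2,
    cancels in [dissipation_le_epsilon]. *)
Lemma abse_correlation_le u l : L2field u -> (0 < l)%R ->
  `|(3 / (8 * pi * l ^+ 3))%:E * \int[mu]_(tau in `[0%R, l]) ((tau ^+ 2)%:E *
     sphere_integral (fun n => inner u (fun x => u (x + tau *: n)%R)))|
  <= (2^-1)%:E * L2norm u ^+ 2.
Proof.
move=> Lu l0; have [_ _ L2u] := Lu.
have : L2norm u ^+ 2 \is a fin_num.
  by rewrite fin_numX// ge0_fin_numE// Lnorm_ge0.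
move=> /fineK; set M := fine _ => ME.
have M0 : (0 <= M)%R.
  by rewrite fine_ge0// sqr_L2norm integral_ge0// => p _; rewrite lee_fin sqr_ge0.
have p0 : (0 < pi :> R)%R by exact: pi_gt0.
have c0 : (0 <= 3 / (8 * pi * l ^+ 3) :> R)%R.
  by rewrite divr_ge0// !mulr_ge0 ?exprn_ge0// ltW.
rewrite abseM gee0_abs ?lee_fin// -ME.
apply: (@le_trans _ _ ((3 / (8 * pi * l ^+ 3))%:E *
    ((4 * pi * M)%:E * (l ^+ 3 / 3)%:E))).
  rewrite lee_wpmul2l ?lee_fin// -integral_sqr; last exact: ltW.
  apply: (le_trans _ (ge0_integralZl_le _ _ _ _ _ _)).
  - apply: le_abse_integral_arbitrary => tau _.
    rewrite abseM gee0_abs ?lee_fin ?sqr_ge0// muleC lee_wpmul2r ?lee_fin ?sqr_ge0//.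
    rewrite -sphere_integral_cst//; apply: abse_sphere_integral_le => n _ /=.
    by rewrite ME; exact: abse_inner_shift_le.
  - by rewrite !mulr_ge0 ?(ltW p0).
  - by move=> tau _; rewrite lee_fin sqr_ge0.
rewrite -!EFinM lee_fin le_eqVlt; apply/orP; left; apply/eqP.
(* [pi] becomes a variable, lest its definition be unfolded by [field]. *)
move: (pi : R) p0 {c0} => q q0; field.
by rewrite !gt_eqF.
Qed.

End energy.

(** * Dissipation, exponents and limits *)

Section dissipation.
Context {R : realType}.
Local Open Scope ereal_scope.
Local Notation mu := (@lebesgue_measure R).

(** By the energy equality, [nu int |grad w|^2] is half the energy at time 0
    minus half the energy at time 1 plus the work of the force; [epsilon] has
    instead of the second term the averaged correlation, which is not larger.
    Finiteness of [epsilon] is that of the work of the force, and then all the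
    terms are real numbers. *)
Lemma dissipation_le_epsilon (nu l : R) (v_in : V3 R -> V3 R)
    (f w : R -> V3 R -> V3 R) :
  (0 < nu)%R -> (0 < l)%R -> leray_hopf nu v_in f w ->
  energy_lhs nu w 1%R = energy_rhs v_in f w 1%R -> epsilon f w l \is a fin_num ->
  nu%:E * \int[mu]_(t in `[0%R, 1%R]) dirichlet (w t) <= epsilon f w l.
Proof.
move=> nu0 l0 lh; rewrite /energy_lhs /energy_rhs /epsilon.
have Lw t : (0 <= t <= 1)%R -> L2field (w t) by exact: lh_L2 lh t.
have [Lin _] := ws_v_in (lh_weak lh).
have L0 : L2field (w 0%R) by apply: Lw; rewrite lexx ler01.
have L1 : L2field (w 1%R) by apply: Lw; rewrite lexx ler01.
have [_ m0 _] := L0; have [_ min fin_in] := Lin; have [_ _ fin1] := L1.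
rewrite (eq_ae_L2norm _ _ m0 min (ws_init (lh_weak lh))).
have := abse_correlation_le _ _ L1 l0.
have : L2norm v_in ^+ 2 \is a fin_num by rewrite fin_numX// ge0_fin_numE// Lnorm_ge0.
have : L2norm (w 1%R) ^+ 2 \is a fin_num by rewrite fin_numX// ge0_fin_numE// Lnorm_ge0.
set corr := (3 / _)%:E * _.
set work := \int[_]_(r in _) inner _ _.
set diss := \int[_]_(r in _) dirichlet _.
move: (L2norm v_in ^+ 2) (L2norm (w 1%R) ^+ 2) => [e0| |]// [e1| |]// _ _.
case: corr => [a| |]//; case: work => [i| |]//; case: diss => [d| |].
- rewrite -!EFinM -!EFinD !lee_fin => /ler_normlP[_ a1] [En] _; lra.
- by rewrite gt0_muley ?lte_fin ?mulr_gt0.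
- by move=> _ _ _; rewrite gt0_muleNy ?lte_fin// leNye.
Qed.

(** The numbers are [4/3 * 1/4 - 1/6 = 1/6]: the 4/3 law with an error of at most
    1/6 leaves at least 1/6 for the size of [int S0 / l]. *)
Lemma integral_S3_ge (nu l : R) (v_in : V3 R -> V3 R)
    (f w : R -> V3 R -> V3 R) :
  (0 < nu)%R -> (0 < l)%R -> leray_hopf nu v_in f w ->
  energy_lhs nu w 1%R = energy_rhs v_in f w 1%R ->
  (4^-1)%:E < nu%:E * \int[mu]_(t in `[0%R, 1%R]) dirichlet (w t) ->
  `|\int[mu]_(r in `[0%R, 1%R]) (S0 (w r) l * (l^-1)%:E)
     + (4 / 3)%:E * epsilon f w l| <= (6^-1)%:E ->
  (6^-1 * l)%:E <= \int[mu]_(r in `[0%R, 1%R]) S3 (w r) l.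
Proof.
move=> nu0 l0 lh en diss S0eps.
have := abse_integral_S0_le w l l0.
have : \int[mu]_(r in `[0%R, 1%R]) (S0 (w r) l * (l^-1)%:E)
    + (4 / 3)%:E * epsilon f w l \is a fin_num.
  by rewrite fin_num_abs (le_lt_trans S0eps)// ltry.
rewrite fin_numD => /andP[Sfin eps43].
have efin : epsilon f w l \is a fin_num.
  by move: eps43; case: (epsilon f w l) => //; rewrite ?gt0_muley ?gt0_muleNy ?lte_fin.
have := lt_le_trans diss (dissipation_le_epsilon _ _ _ _ _ nu0 l0 lh en efin).
move: S0eps; set S := integral _ _ _ in Sfin *.
move: (epsilon f w l) efin => [e| |]// _; case: S Sfin => [s| |]// _.
rewrite -EFinM -EFinD !lee_fin lte_fin => /ler_normlP[s1 s2] e1.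
rewrite lee_pdivlMl// => sS; apply: le_trans sS.
rewrite -EFinM lee_fin mulrC ler_wpM2l ?ltW//.
have : (`|s| >= - s)%R by rewrite -normrN ler_norm.
lra.
Qed.

End dissipation.

Section exponents.
Context {R : realType}.
Implicit Types (w : R -> V3 R -> V3 R) (l C e b : R).

(** In the comparison of [ln (C l^b)] with [b ln l], the constant costs at most
    [e] in the exponent, for all small [l]. *)
Lemma neg_ln_dominates C e : 1 <= C -> 0 < e -> exists2 d, 0 < d &
  forall l, 0 < l -> l <= d -> ln l < 0 /\ ln C <= - (e * ln l).
Proof.
move=> C1 e0.
(* [ln l <= - ln C / e] gives the inequality, and the extra [- 1] makes [ln l]
   negative even when [C = 1]. *)
exists (expR (- (ln C / e) - 1)); first exact: expR_gt0.
move=> l l0; rewrite -[l in l <= _]lnK ?posrE// ler_expR => ll.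
have c0 : 0 <= ln C by exact: ln_ge0.
have ce0 : 0 <= ln C / e by rewrite divr_ge0// ltW.
split; first by lra.
rewrite -mulrN mulrC -ler_pdivrMr//; lra.
Qed.

(** The inequality is reversed on dividing by [ln l < 0]. A vanishing integral
    gives the exponent [+oo]. *)
Lemma S3_exponent_ge w l C b e : 0 < C -> 0 < l -> ln l < 0 ->
  ln C <= - (e * ln l) ->
  (\int[@lebesgue_measure R]_(r in `[0%R, 1%R]) S3 (w r) l <= (C * l `^ b)%:E)%E ->
  ((b - e)%:E <= S3_exponent w l)%E.
Proof.
move=> C0 l0 ll Ce wl; rewrite /S3_exponent.
have i0 : (0 <= \int[@lebesgue_measure R]_(r in `[0%R, 1%R]) S3 (w r) l)%E.
  by apply: integral_ge0 => r _; exact: S3_ge0.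
have b0 : 0 < C * l `^ b by rewrite mulr_gt0// powR_gt0.
have : (lne (\int[@lebesgue_measure R]_(r in `[0%R, 1%R]) S3 (w r) l) <=
    lne (C * l `^ b)%:E)%E.
  by rewrite lee_lne// in_itv/= ?i0 ?leey ?lee_fin ?(ltW b0).
rewrite lne_EFin// lnM ?posrE ?powR_gt0// ln_powR.
case: (lne _) => [r| |]//.
  rewrite lee_fin => rb; rewrite -EFinM lee_fin ler_ndivlMr//.
  by rewrite mulrBl; lra.
by rewrite mulNyr ltr0_sg ?invr_lt0// mulN1e leey.
Qed.

(** A divergent integral gives the exponent [-oo]. *)
Lemma S3_exponent_le w l C b e : 0 < C -> 0 < l -> ln l < 0 ->
  ln C <= - (e * ln l) ->
  ((C^-1 * l `^ b)%:E <= \int[@lebesgue_measure R]_(r in `[0%R, 1%R]) S3 (w r) l)%E ->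
  (S3_exponent w l <= (b + e)%:E)%E.
Proof.
move=> C0 l0 ll Ce wl; rewrite /S3_exponent.
have i0 : (0 <= \int[@lebesgue_measure R]_(r in `[0%R, 1%R]) S3 (w r) l)%E.
  by apply: integral_ge0 => r _; exact: S3_ge0.
have b0 : 0 < C^-1 * l `^ b by rewrite mulr_gt0 ?invr_gt0 ?powR_gt0.
have : (lne (C^-1 * l `^ b)%:E <=
    lne (\int[@lebesgue_measure R]_(r in `[0%R, 1%R]) S3 (w r) l))%E.
  by rewrite lee_lne// in_itv/= ?i0 ?leey ?lee_fin ?(ltW b0).
rewrite lne_EFin// lnM ?posrE ?powR_gt0 ?invr_gt0// ln_powR lnV ?posrE//.
case: (lne _) => [r| |]//.
  rewrite lee_fin => rb; rewrite -EFinM lee_fin ler_ndivrMr//.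
  by rewrite mulrDl; lra.
by rewrite mulyr ltr0_sg ?invr_lt0// mulN1e leNye.
Qed.

End exponents.

Section limits_along_filters.
Context {T : choiceType} {X : filteredType T} {R : realType}.
Local Open Scope ereal_scope.
Implicit Types (f g : X -> \bar R) (F : set (set X)) (a : \bar R).

Lemma le_limf_einf f F a : F [set x | a <= f x] -> a <= limf_einf f F.
Proof.
move=> Fa; rewrite limf_einfE; apply: le_ereal_sup_tmp.
exists (ereal_inf (f @` [set x | a <= f x])); first by exists [set x | a <= f x].
by apply: le_ereal_inf_tmp => _ [x /= ax <-].
Qed.

Lemma limf_esup_le f F a : F [set x | f x <= a] -> limf_esup f F <= a.
Proof.
move=> Fa; apply: ge_ereal_inf.
exists (ereal_sup (f @` [set x | f x <= a])); first by exists [set x | f x <= a].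
by apply: ge_ereal_sup => _ [x /= ax <-].
Qed.

Lemma limf_einf_le f F a :
  (forall V, F V -> exists2 x, V x & f x <= a) -> limf_einf f F <= a.
Proof.
move=> Fa; rewrite limf_einfE; apply: ge_ereal_sup => _ [V /Fa[x Vx fxa] <-].
by apply: ge_ereal_inf; exists (f x) => //; exists x.
Qed.

Lemma limf_esup_lt f F a : Filter F -> limf_esup f F < a -> F [set x | f x < a].
Proof.
move=> FF /ereal_inf_lt[_ [V FV <-] Va]; apply: filterS FV => x Vx /=.
by apply: le_lt_trans Va; apply: ereal_sup_ubound; exists x.
Qed.

Lemma lt_limf_esup f F a V : a < limf_esup f F -> F V -> exists2 x, V x & a < f x.
Proof.
move=> aF FV; have : a < ereal_sup (f @` V).
  by apply: lt_le_trans aF _; apply: ereal_inf_lbound; exists V.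
by move=> /ereal_sup_gt[_ [x Vx <-] ax]; exists x.
Qed.

Lemma le_limf_einf_esup f g F : ProperFilter F -> F [set x | f x <= g x] ->
  limf_einf f F <= limf_esup g F.
Proof.
move=> PF Ffg; rewrite limf_einfE; apply: ge_ereal_sup => _ [V FV <-].
apply: le_ereal_inf_tmp => _ [W FW <-].
have FF : Filter F by exact: PF.
have [x [[Vx Wx] fg]] := @filter_ex _ _ PF _ (filterI (filterI FV FW) Ffg).
apply: (@le_trans _ _ (f x)); first by apply: ereal_inf_lbound; exists x.
by apply: (le_trans fg); apply: ereal_sup_ubound; exists x.
Qed.

End limits_along_filters.

(** * The three inequalities *)

Section exponent_bounds.
Context {R : realType}.
Implicit Types (v f : R -> R -> V3 R -> V3 R) (K alpha : R).
Local Open Scope ereal_scope.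

(** The norms are bounded uniformly in [nu], so that one constant serves all the
    viscosities over which the infimum is taken. *)
Lemma zeta3_ge alpha K v (M : \bar R) : M < +oo ->
  (forall nu : R, (0 < nu < 1)%R -> Lt 3%:E (Cnorm alpha) (v nu) <= M) ->
  (3 * alpha)%:E <= zeta3 K v.
Proof.
move=> Moo vM.
(* A real bound, also in the degenerate case [M = -oo]. *)
have [B B0 vB] : exists2 B : R, (0 <= B)%R &
    forall nu : R, (0 < nu < 1)%R -> Lt 3%:E (Cnorm alpha) (v nu) <= B%:E.
  exists (Num.max 0%R (fine M)) => [|nu nu01]; first by rewrite le_max lexx.
  apply: (le_trans (vM _ nu01)); case: M Moo {vM} => [r| |]//= _; last exact: leNye.
  by rewrite lee_fin le_max lexx orbT.
apply/lee_addgt0Pr => e e0; rewrite -leeBlDr// -EFinB.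
have C1 : (1 <= 1 + B `^ 3)%R by rewrite lerDl powR_ge0.
have [d d0 dP] := neg_ln_dominates _ _ C1 e0.
apply: le_limf_einf; apply: filterS (nbhs_right_le d0) => lI /= lId.
apply: le_ereal_inf_tmp => _ [nu /= + <-]; rewrite in_itv/= => nu01.
apply: le_ereal_inf_tmp => _ [l /= + <-]; rewrite in_itv/= => /andP[nul llI].
have [nu0 _] := andP nu01.
have l0 : (0 < l)%R by apply: lt_le_trans nul; exact: powR_gt0.
have [ll lC] := dP l l0 (le_trans llI lId).
apply: (S3_exponent_ge _ _ _ _ _ _ l0 ll lC); first by lra.
apply: (le_trans (integral_S3_le alpha (v nu) l l0)).
rewrite EFinM [leRHS]muleC lee_wpmul2l ?lee_fin ?powR_ge0//.
apply: (@le_trans _ _ (B%:E `^ 3)); last first.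
  by rewrite poweR_EFin lee_fin lerDr.
apply: gt0_ler_poweR; rewrite ?in_itv/= ?leey ?andbT ?Lnorm_ge0 ?lee_fin//.
exact: vB.
Qed.

(** For [nu <= l_I ^ (1 / K)] the scale [l_I] itself lies in [[nu ^ K, l_I]]: the
    exponent there is between the infimum and the supremum. *)
Lemma zeta3_le_zeta3_bar K v : (0 < K)%R -> zeta3 K v <= zeta3_bar K v.
Proof.
move=> K0; apply: le_limf_einf_esup.
near=> lI; have lI0 : (0 < lI)%R by near: lI; exact: nbhs_right_gt.
apply: le_limf_einf.
near=> nu; have nu0 : (0 < nu)%R by near: nu; exact: nbhs_right_gt.
have nu1 : (nu < 1)%R by near: nu; exact: nbhs_right_lt.
have nulI : (nu <= lI `^ K^-1)%R.
  by near: nu; apply: nbhs_right_le; exact: powR_gt0.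
have lIin : `[(nu `^ K)%R, lI]%classic lI.
  rewrite /= in_itv/= lexx andbT.
  have -> : lI = ((lI `^ K^-1) `^ K)%R.
    by rewrite -powRrM mulVf ?gt_eqF// powRr1// (ltW lI0).
  by apply: ge0_ler_powR; rewrite ?nnegrE ?powR_ge0 ?(ltW nu0) ?(ltW K0).
apply: (@le_trans _ _ (S3_exponent (v nu) lI)).
  apply: ge_ereal_inf; exists (ereal_inf
    [set S3_exponent (v nu) l | l in `[(nu `^ K)%R, lI]%classic]).
    by exists nu => //=; rewrite in_itv/= nu0.
  by apply: ereal_inf_lbound; exists lI.
by apply: ereal_sup_ubound; exists lI.
Unshelve. all: by end_near. Qed.

(** [D] stands for the dissipation [nu int |grad v_nu|^2]: it is larger than 1/4 only
    frequently as [nu] tends to 0, while the 4/3 law holds for all small [nu]: the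
    two meet along a sequence of viscosities, which bounds the lower limit in
    [nu]. *)
Lemma zeta3_bar_le K f v (D : R -> \bar R) :
  (4^-1)%:E < limf_esup D 0%R^'+ ->
  limf_esup (fun nu : R => ereal_sup
        [set `|\int[@lebesgue_measure R]_(r in `[0%R, 1%R])
                  (S0 (v nu r) l * (l^-1)%:E)
               + (4 / 3)%:E * epsilon (f nu) (v nu) l|%E
        | l in `[(nu `^ K)%R, l_I]]) 0%R^'+
      @[l_I --> (0 : R)%R^'+] --> 0%E ->
  (forall nu l : R, (0 < nu < 1)%R -> (0 < l)%R -> (4^-1)%:E < D nu ->
    `|\int[@lebesgue_measure R]_(r in `[0%R, 1%R]) (S0 (v nu r) l * (l^-1)%:E)
     + (4 / 3)%:E * epsilon (f nu) (v nu) l| <= (6^-1)%:E ->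
    (6^-1 * l)%:E <= \int[@lebesgue_measure R]_(r in `[0%R, 1%R]) S3 (v nu r) l) ->
  zeta3_bar K v <= 1.
Proof.
move=> hD hlim hS3; apply/lee_addgt0Pr => e e0; rewrite -EFinD.
have [d d0 dP] := neg_ln_dominates _ _ (ler1n R 6) e0.
have six : (0 : \bar R) < (6^-1)%:E by rewrite lte_fin invr_gt0.
apply: limf_esup_le; near=> lI.
have lId : (lI <= d)%R by near: lI; exact: nbhs_right_le.
apply: limf_einf_le => V FV.
have small : limf_esup (fun nu : R => ereal_sup
        [set `|\int[@lebesgue_measure R]_(r in `[0%R, 1%R])
                  (S0 (v nu r) l * (l^-1)%:E)
               + (4 / 3)%:E * epsilon (f nu) (v nu) l|%E
        | l in `[(nu `^ K)%R, lI]]) 0%R^'+ < (6^-1)%:E.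
  near: lI; exact: hlim (open_ereal_lt' six).
have FF : Filter (0%R : R)^'+ by exact: at_right_proper_filter.
have FVW := filterI (filterI FV (nbhs_right_gt (0%R : R)))
  (filterI (nbhs_right_lt (ltr01 : (0 < 1 :> R)%R)) (limf_esup_lt _ _ _ FF small)).
have [nu [[Vnu /= nu0] [/= nu1 nusmall]] Dnu] := lt_limf_esup _ _ _ _ hD (FVW FF FF FF).
exists nu => //; apply: ge_ereal_sup => _ [l /= + <-]; rewrite in_itv/= => /andP[nul llI].
have l0 : (0 < l)%R by apply: lt_le_trans nul; exact: powR_gt0.
have [ll lC] := dP l l0 (le_trans llI lId).
apply: (S3_exponent_le _ _ _ _ _ _ l0 ll lC) => //.
rewrite powRr1 ?(ltW l0)//; apply: hS3 => //; first by rewrite nu0.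
apply/ltW; apply: le_lt_trans nusmall; apply: ereal_sup_ubound.
by exists l => //=; rewrite in_itv/= nul.
Unshelve. all: by end_near. Qed.

End exponent_bounds.

Theorem theorem1p4 (R : realType) (alpha K : R) (v_in : V3 R -> V3 R)
    (f v : R -> R -> V3 R -> V3 R) (halpha : 0 < alpha < 1 / 3)
    (hv : BCCDS alpha v_in f v) (hK : dissipation_scale f v K) :
  [/\ ((3 * alpha)%:E <= zeta3 K v)%E,
      (zeta3 K v <= zeta3_bar K v)%E &
      (zeta3_bar K v <= 1)%E].
Proof.
split.
- apply: zeta3_ge (bccds_bound hv) _ => nu nu01.
  apply: (@le_trans _ _ (Lt 3%:E (Cnorm alpha) (v nu) + Lt +oo Linftynorm (v nu))%E).
    by rewrite leeDl// Lnorm_ge0.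
  by apply: ereal_sup_ubound; exists nu => //=; rewrite in_itv.
- by have [sigma [a [q [_ _ _ _ /andP[K0 _]]]]] := ds_bound hK; exact: zeta3_le_zeta3_bar.
- apply: zeta3_bar_le (bccds_anomalous_dissipation hv) (ds_limit hK) _.
  move=> nu l nu01 l0; have [nu0 _] := andP nu01.
  apply: integral_S3_ge nu0 l0 (bccds_leray_hopf hv nu01) _.
  by apply: (bccds_energy_equality hv nu01); rewrite ltr01 lexx.
Qed.
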